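(* Let $S$ be a data set consisting of $n\ge 3$ points in $\mathbb{R}^2$ and let $q\in\mathbb{R}^2$. Then $\mathrm{SphD}(q;S)\ge \frac{2}{3}\,\mathrm{SD}(q;S)$.
   Context: For $a,b\in\mathbb{R}^2$, the sphere area $\mathrm{Sph}(a,b)$ is the closed disk with diameter $\overline{ab}$: $\mathrm{Sph}(a,b)=\{t\in\mathbb{R}^2 : d(t,\frac{a+b}{2})\le \frac{d(a,b)}{2}\}$, where $d$ is the Euclidean distance. For $S=\{x_1,\dots,x_n\}\subset\mathbb{R}^2$ a set of $n$ points, the spherical depth is $$\mathrm{SphD}(q;S)=\frac{1}{\binom n2}\,\bigl|\{(i,j): 1\le i<j\le n,\ q\in \mathrm{Sph}(x_i,x_j)\}\bigr|,$$ and the simplicial depth is the proportion of closed triangles with vertices in $S$ that contain $q$: $$\mathrm{SD}(q;S)=\frac{1}{\binom n3}\,\bigl|\{(i,j,k): 1\le i<j<k\le n,\ q\in \mathrm{conv}\{x_i,x_j,x_k\}\}\bigr|.$$ *)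

(* Defs.v *)
From mathcomp Require Import all_boot all_order all_algebra.
From mathcomp Require Import boolp classical_sets reals convex.

Set Implicit Arguments.
Unset Strict Implicit.
Unset Printing Implicit Defensive.

Import Order.TTheory GRing.Theory Num.Theory.

Local Open Scope classical_set_scope.
Local Open Scope ring_scope.

(* Points of R^2 are row vectors. The library's norm on 'rV[R]_2 is the sup
   norm, hence an explicit Euclidean distance. *)
Definition edist (R : realType) (a b : 'rV[R]_2) : R :=
  Num.sqrt (\sum_(i < 2) (a 0 i - b 0 i) ^+ 2).

Definition Sph (R : realType) (a b : 'rV[R]_2) : set 'rV[R]_2 :=
  [set t | edist t (2^-1 *: (a + b)) <= edist a b / 2].

Definition convex_hull (R : realType) (A : set 'rV[R]_2) : set 'rV[R]_2 :=
  smallest (@convex_set R 'rV[R]_2) A.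

(* A data set {x_1, ..., x_n} is given by an enumeration x : 'I_n -> 'rV[R]_2;
   the points are distinct when x is injective. *)
Definition SphD (R : realType) (n : nat) (q : 'rV[R]_2)
    (x : 'I_n -> 'rV[R]_2) : R :=
  ('C(n, 2)%:R)^-1 *
  #|[set p : 'I_n * 'I_n |
      (p.1 < p.2)%N && `[< Sph (x p.1) (x p.2) q >]]%SET|%:R.

Definition SD (R : realType) (n : nat) (q : 'rV[R]_2)
    (x : 'I_n -> 'rV[R]_2) : R :=
  ('C(n, 3)%:R)^-1 *
  #|[set p : 'I_n * 'I_n * 'I_n |
      (p.1.1 < p.1.2 < p.2)%N &&
      `[< convex_hull [set x p.1.1; x p.1.2; x p.2] q >]]%SET|%:R.

(* Main.v *)
(* A point q lies in the disk with diameter ab iff (a - q).(b - q) <= 0. If q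
   is in the triangle abc, then at least two of the three disks on its sides
   contain q: otherwise two sides sharing a vertex, say a, give positive inner
   products, so a, b and c all lie in the open half-plane
   {p | (a - q).(p - q) > 0}, which does not contain q. Each pair of points
   belongs to n - 2 triangles, so twice the number of triangles containing q is
   at most n - 2 times the number of disks containing q. *)
Require Import Defs.
From mathcomp Require Import all_boot all_order all_algebra.
From mathcomp Require Import boolp classical_sets reals convex.
From mathcomp Require Import ring lra zify.

Import Order.TTheory GRing.Theory Num.Theory.
Local Open Scope ring_scope.

Definition dot {R : realType} (u v : 'rV[R]_2) : R := \sum_(i < 2) u 0 i * v 0 i.

(** With m the midpoint of [a] and [b], |q - m|^2 - |a - b|^2 / 4 = (a - q).(b - q). *)
Lemma notin_Sph {R : realType} (a b q : 'rV[R]_2) :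
  ~ Sph a b q -> 0 < dot (a - q) (b - q).
Proof.
move=> nab; rewrite ltNge; apply/negP => ab_le0; apply: nab.
(* The factor 2 becomes sqrt (2 ^ 2), so that only the radicands remain to be compared. *)
rewrite /Sph /edist /= ler_pdivlMr // -[X in _ * X]ger0_norm // -sqrtr_sqr.
rewrite -sqrtrM; last by apply: sumr_ge0 => i _; exact: sqr_ge0.
apply: ler_wsqrtr; move: ab_le0.
rewrite /dot !big_ord_recl !big_ord0 !mxE; lra.
Qed.

(** Puts the apex in its own half-plane: a null vector has inner product 0 with every vector. *)
Lemma dot_self_gt0 {R : realType} (u v : 'rV[R]_2) : 0 < dot u v -> 0 < dot u u.
Proof.
move=> uv; have uu : 0 <= dot u u by apply: sumr_ge0 => i _; exact: sqr_ge0.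
rewrite lt_def uu andbT; apply: contraTneq uv => /eqP.
rewrite psumr_eq0 => [/allP u0|i _]; last exact: sqr_ge0.
rewrite -leNgt /dot big1 // => i _.
by have := u0 i (mem_index_enum i); rewrite mulf_eq0 orbb => /eqP ->; rewrite mul0r.
Qed.

(** The set of [p] with [0 < dot u (p - q)] is convex, so it contains the hull of [A]; at [q] the
    product is 0. *)
Lemma notin_convex_hull_halfspace {R : realType} (A : set 'rV[R]_2)
    (u q : 'rV[R]_2) :
  (forall p, A p -> 0 < dot u (p - q)) -> ~ convex_hull A q.
Proof.
move=> Au /(_ [set p | 0 < dot u (p - q)]%classic) /=.
rewrite subrr; have -> : dot u 0 = 0 by apply: big1 => i _; rewrite mxE mulr0.
rewrite ltxx => hull; suff : false by []; apply: hull; split=> // p r t.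
rewrite !inE /= => up ur.
(* The map sending [p] to [dot u (p - q)] is affine. *)
suff -> : dot u (conv t p r - q)
    = conv t (dot u (p - q) : R^o) (dot u (r - q)) by exact: convR_gt0.
rewrite convRE /dot !big_ord_recl !big_ord0 !mxE /unstable.onem /=; ring.
Qed.

Lemma triangle_two_Sph {R : realType} (a b c q : 'rV[R]_2) :
  convex_hull [set a; b; c]%classic q ->
  (2 <= `[< Sph a b q >] + `[< Sph b c q >] + `[< Sph a c q >])%N.
Proof.
move=> hull.
have apex p r s : ([set a; b; c] `<=` [set p; r; s])%classic ->
    ~ Sph p r q -> ~ Sph p s q -> False.
  move=> sub /notin_Sph pr /notin_Sph ps.
  apply: (@notin_convex_hull_halfspace _ [set a; b; c]%classic (p - q)) hull.
  by move=> _ /sub[[->|->]|->]; [exact: dot_self_gt0 pr | |].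
have Sph_sym p r : Sph p r q -> Sph r p q.
  rewrite /Sph /edist /= addrC; congr (_ <= Num.sqrt _ / _).
  by apply: eq_bigr => i _; rewrite -sqrrN opprB.
(* Four cases survive, each with at most one disk containing [q]; the apex is a vertex shared by two
   sides whose disks miss [q]. *)
case: (asboolP (Sph a b q)) => ab; case: (asboolP (Sph b c q)) => bc;
  case: (asboolP (Sph a c q)) => ac //; exfalso.
- by apply: (@apex c b a) => [p [[]|]|/Sph_sym|/Sph_sym] //=; auto.
- by apply: (@apex a b c).
- by apply: (@apex b a c) => [p [[]|]|/Sph_sym|] //=; auto.
- by apply: (@apex a b c).
Qed.

Lemma card_triples_le {n : nat} (e : rel 'I_n) (t : 'I_n -> 'I_n -> 'I_n -> bool) :
  (forall i j k, t i j k -> 2 <= e i j + e j k + e i k)%N ->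
  (2 * #|[set p : 'I_n * 'I_n * 'I_n |
           (p.1.1 < p.1.2 < p.2)%N && t p.1.1 p.1.2 p.2]| <=
   (n - 2) * #|[set p : 'I_n * 'I_n | (p.1 < p.2)%N && e p.1 p.2]|)%N.
Proof.
move=> te.
have -> : #|[set p : 'I_n * 'I_n * 'I_n |
      (p.1.1 < p.1.2 < p.2)%N && t p.1.1 p.1.2 p.2]| =
    (\sum_(i < n) \sum_(j < n) \sum_(k < n) ((i < j < k) && t i j k))%N.
  rewrite pair_bigA pair_bigA /= -sum1_card big_mkcond.
  by apply: eq_bigr => p _; rewrite inE; case: ifP.
have -> : #|[set p : 'I_n * 'I_n | (p.1 < p.2)%N && e p.1 p.2]| =
    (\sum_(i < n) \sum_(j < n) ((i < j) && e i j))%N.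
  rewrite pair_bigA /= -sum1_card big_mkcond.
  by apply: eq_bigr => p _; rewrite inE; case: ifP.
pose F (i j k : 'I_n) : nat := (i < j < k)%N && e i j.
pose G (i j k : 'I_n) : nat := (i < j < k)%N && e j k.
pose H (i j k : 'I_n) : nat := (i < j < k)%N && e i k.
apply: (@leq_trans (\sum_(i < n) \sum_(j < n) \sum_(k < n)
    (F i j k + G i j k + H i j k))%N).
  do 3![rewrite big_distrr; apply: leq_sum => ? _ /=].
  rewrite /F /G /H; case: (_ < _ < _)%N => //=.
  by case: (boolP (t _ _ _)) => // /te.
(* Reindex so that the pair is always i < j; the third index k then lies above,
   below or between. *)
have -> : (\sum_(i < n) \sum_(j < n) \sum_(k < n) (F i j k + G i j k + H i j k) =
    \sum_(i < n) \sum_(j < n) \sum_(k < n) (F i j k + G k i j + H i k j))%N.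
  under eq_bigr do under eq_bigr do rewrite !big_split /=.
  under eq_bigr do rewrite !big_split /=.
  under [RHS]eq_bigr do under eq_bigr do rewrite !big_split /=.
  under [RHS]eq_bigr do rewrite !big_split /=.
  rewrite !big_split /=; congr (_ + _ + _)%N.
    rewrite exchange_big; apply: eq_bigr => i _.
    by rewrite exchange_big.
  by apply: eq_bigr => i _; rewrite exchange_big.
rewrite big_distrr; apply: leq_sum => i _ /=.
rewrite big_distrr; apply: leq_sum => j _ /=.
case: (boolP ((i < j)%N && e i j)) => [/andP[ij eij]|nij]; last first.
  (* Each of the three summands forces both [i < j] and [e i j]. *)
  rewrite muln0 big1 // => k _; move: nij; rewrite /F /G /H.
  by case: (e i j) => //=; rewrite ?andbF ?andbT //; lia.
have -> : (n - 2 = #|~: [set i; j]|)%N.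
  by rewrite cardsCs finset.setCK card_ord cards2 -(inj_eq val_inj) /= ltn_eqF.
rewrite muln1 -sum1_card [leqRHS]big_mkcond /=; apply: leq_sum => k _.
(* The positions of [k] in the three summands exclude one another, and none allows [k] to be [i] or
   [j]. *)
rewrite !inE -!(inj_eq val_inj) /F /G /H eij ij !andbT /=.
case: (ltngtP k i); case: (ltngtP k j) => //= kj ki; lia.
Qed.

Theorem theorem4p4 (R : realType) (n : nat) (hn : (3 <= n)%N)
  (x : 'I_n -> 'rV[R]_2) (hx : injective x) (q : 'rV[R]_2) :
  2 / 3 * SD q x <= SphD q x.
Proof.
have := @card_triples_le n (fun i j => `[< Sph (x i) (x j) q >]) _
  (fun i j k => @triangle_two_Sph R (x i) (x j) (x k) q \o (@asboolW _)).
rewrite /SD /SphD -(ler_nat R) !natrM natrB ?(ltnW hn) //.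
set T := #|_|%:R; set P := #|_|%:R => le_TP.
have n2 : 2 < n%:R :> R by rewrite ltr_nat.
have c2 : 0 < 'C(n, 2)%:R :> R by rewrite ltr0n bin_gt0 ltnW.
(* 3 C(n,3) = (n - 2) C(n,2): this ratio is the source of the 3 in 2/3. *)
have /(congr1 (fun m => m%:R : R)) := mul_bin_left n 2.
rewrite !natrM natrB ?(ltnW hn) // => c3E.
have -> : 'C(n, 3)%:R = (n%:R - 2) * 'C(n, 2)%:R / 3 :> R by lra.
have -> : 2 / 3 * (((n%:R - 2) * 'C(n, 2)%:R / 3)^-1 * T)
    = 'C(n, 2)%:R^-1 * (2 * T / (n%:R - 2)).
  by field; rewrite !gt_eqF // subr_gt0.
apply: ler_wpM2l; first by rewrite invr_ge0 ler0n.
by rewrite ler_pdivrMr ?subr_gt0 // [leRHS]mulrC.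
Qed.
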